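(* Let $I\subset\mathbb R$ be an open interval and let $f,g,\rho:I\to\mathbb R$ be smooth functions such that $(f')^2+(g')^2-(\rho')^2=1$ on $I$ and such that $f'$, $g'$, $\rho'$ and $\rho$ vanish nowhere on $I$. Let $M$ be the spacelike surface of revolution of hyperbolic type in $\mathbb R_1^4$ given by $$\mathbf X(u,v)=\bigl(f(u),\,g(u),\,\rho(u)\sinh v,\,\rho(u)\cosh v\bigr),\qquad u\in I,\ v\in\mathbb R.$$ If $M$ is maximal, then $M$ is contained in a timelike hyperplane and is parametrized by $$f(u)=\frac{\sqrt{C_3}}{1+C_2^2}\arcsin\left(\frac{u-C_1}{\sqrt{C_3}}\right)+m,$$ $$g(u)=C_2f(u)+k,$$ $$\rho(u)=\pm\sqrt{C_3-(u-C_1)^2},$$ where $C_1$, $C_2$, $C_3>0$, $m$, $k$ are constants.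
   Context: The Lorentz-Minkowski space $\mathbb R_1^4$ is $\mathbb R^4$ with the pseudo scalar product $\langle \mathbf x,\mathbf y\rangle=x_1y_1+x_2y_2+x_3y_3-x_4y_4$. A nonzero vector $\mathbf x$ is spacelike, lightlike or timelike if $\langle \mathbf x,\mathbf x\rangle$ is $>0$, $=0$ or $<0$, respectively. For a nonzero vector $\mathbf n$ and $c\in\mathbb R$, the hyperplane $HP(\mathbf n,c)=\{\mathbf x:\langle\mathbf x,\mathbf n\rangle=c\}$ is called timelike if $\mathbf n$ is spacelike. A spacelike surface $M$ in $\mathbb R_1^4$ is a smooth (immersed) surface whose induced first fundamental form is positive definite at each point; its normal planes are then timelike. Let $\{e_3,e_4\}$ be a (local) orthonormal frame of the normal bundle of $M$ with $\langle e_3,e_3\rangle=1$, $\langle e_4,e_4\rangle=-1$, and let $A^{e_3},A^{e_4}$ be the associated shape operators (for a normal field $\nu$, $A^\nu$ is minus the tangential component of $d\nu$). The mean curvature vector of $M$ is $H=\frac12(\operatorname{trace}A^{e_3})e_3-\frac12(\operatorname{trace}A^{e_4})e_4$. $M$ is called maximal if $H=0$ everywhere on $M$.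
   Formalization: The printed formula for f is false (e.g. f=g=arcsin(u/√2), ρ=√(2−u²) on (0,1)); the formal statement has the factor √C₃/√(1+C₂²) in place of √C₃/(1+C₂²), and a constant sign ± in front of it, since f may be decreasing. *)

(* Defs.v *)
From Stdlib Require Import Reals.
From Coquelicot Require Import Coquelicot.
Open Scope R_scope.

Notation R4 := (R * R * R * R)%type.

Definition x1 (x : R4) : R := fst (fst (fst x)).
Definition x2 (x : R4) : R := snd (fst (fst x)).
Definition x3 (x : R4) : R := snd (fst x).
Definition x4 (x : R4) : R := snd x.

Definition lorentz (x y : R4) : R :=
  x1 x * x1 y + x2 x * x2 y + x3 x * x3 y - x4 x * x4 y.

Definition spacelike (x : R4) : Prop := x <> zero /\ 0 < lorentz x x.

Definition HP (n : R4) (c : R) (x : R4) : Prop := lorentz x n = c.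

(* The end points may be infinite, so this covers every open interval of R. *)
Definition open_itv (a b : Rbar) (u : R) : Prop := Rbar_lt a u /\ Rbar_lt u b.

Definition smooth_on (I : R -> Prop) (f : R -> R) : Prop :=
  forall (n : nat) (u : R), I u -> ex_derive_n f n u.

Definition open2 (D : R -> R -> Prop) : Prop :=
  forall u v, D u v -> locally_2d D u v.

Definition smooth_map (D : R -> R -> Prop) (F : R -> R -> R4) : Prop :=
  forall (n : nat) (u v : R), D u v ->
    ex_diff_n (fun s t => x1 (F s t)) n u v /\
    ex_diff_n (fun s t => x2 (F s t)) n u v /\
    ex_diff_n (fun s t => x3 (F s t)) n u v /\
    ex_diff_n (fun s t => x4 (F s t)) n u v.

Definition partial_u (F : R -> R -> R4) (u v : R) : R4 :=
  (Derive (fun t => x1 (F t v)) u, Derive (fun t => x2 (F t v)) u,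
   Derive (fun t => x3 (F t v)) u, Derive (fun t => x4 (F t v)) u).

Definition partial_v (F : R -> R -> R4) (u v : R) : R4 :=
  (Derive (fun t => x1 (F u t)) v, Derive (fun t => x2 (F u t)) v,
   Derive (fun t => x3 (F u t)) v, Derive (fun t => x4 (F u t)) v).

Definition tangent_vector (X : R -> R -> R4) (u v a b : R) : R4 :=
  plus (scal a (partial_u X u v)) (scal b (partial_v X u v)).

(* Positive definiteness makes the two partial derivatives independent, so X
   is an immersion. *)
Definition spacelike_surface (D : R -> R -> Prop) (X : R -> R -> R4) : Prop :=
  smooth_map D X /\
  forall u v a b, D u v -> (a, b) <> (0, 0) ->
    0 < lorentz (tangent_vector X u v a b) (tangent_vector X u v a b).

Definition normal_vector (X : R -> R -> R4) (u v : R) (w : R4) : Prop :=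
  forall a b, lorentz w (tangent_vector X u v a b) = 0.

Definition tangential_component (X : R -> R -> R4) (u v : R) (w t : R4) : Prop :=
  (exists a b, t = tangent_vector X u v a b) /\ normal_vector X u v (minus w t).

Definition orthonormal_normal_frame (D : R -> R -> Prop)
    (X e3 e4 : R -> R -> R4) : Prop :=
  smooth_map D e3 /\ smooth_map D e4 /\
  forall u v, D u v ->
    normal_vector X u v (e3 u v) /\ normal_vector X u v (e4 u v) /\
    lorentz (e3 u v) (e3 u v) = 1 /\ lorentz (e4 u v) (e4 u v) = -1 /\
    lorentz (e3 u v) (e4 u v) = 0.

(* A is the matrix of the shape operator at (u, v) in the basis
   (partial_u X, partial_v X): the columns of A are the images of the basis. *)
Definition shape_operator (X nu : R -> R -> R4) (u v : R) (A : matrix 2 2) : Prop :=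
  tangential_component X u v (opp (partial_u nu u v))
    (tangent_vector X u v (coeff_mat 0 A 0 0) (coeff_mat 0 A 1 0)) /\
  tangential_component X u v (opp (partial_v nu u v))
    (tangent_vector X u v (coeff_mat 0 A 0 1) (coeff_mat 0 A 1 1)).

Definition trace (A : matrix 2 2) : R := coeff_mat 0 A 0 0 + coeff_mat 0 A 1 1.

(* H is computed from a local frame around (u, v); its value does not depend on
   the frame. *)
Definition mean_curvature_vector (D : R -> R -> Prop) (X : R -> R -> R4)
    (u v : R) (H : R4) : Prop :=
  exists (V : R -> R -> Prop) (e3 e4 : R -> R -> R4) (A3 A4 : matrix 2 2),
    open2 V /\ (forall s t, V s t -> D s t) /\ V u v /\
    orthonormal_normal_frame V X e3 e4 /\
    shape_operator X e3 u v A3 /\ shape_operator X e4 u v A4 /\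
    H = minus (scal (/ 2 * trace A3) (e3 u v)) (scal (/ 2 * trace A4) (e4 u v)).

Definition maximal (D : R -> R -> Prop) (X : R -> R -> R4) : Prop :=
  spacelike_surface D X /\
  forall u v, D u v -> mean_curvature_vector D X u v zero.

Definition hyperbolic_revolution (f g rho : R -> R) (u v : R) : R4 :=
  (f u, g u, rho u * sinh v, rho u * cosh v).

(* Main.v *)
(** Up to sign, twice the mean curvature vector is the normal part of
    [L = X_uu + X_vv / rho^2], since [X_u], [X_v] are orthogonal of square norms
    [1] and [rho^2].  So maximality says that [L] is tangent; as [L] is
    orthogonal to [X_v], this means [L = <L, X_u> X_u] with
    [<L, X_u> = - rho' / rho].  Hence
    [(rho f')' = (rho g')' = 0] and [(rho rho')' = -1], which integrate to
    [rho f' = A], [rho g' = B] and [rho^2 = C3 - (u - C1)^2], and the unit speed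
    condition gives [A^2 + B^2 = C3]. *)

Require Import Defs.
From Stdlib Require Import Reals Lra Classical.
From Coquelicot Require Import Coquelicot.
Open Scope R_scope.

(** * Calculus on open intervals *)

Lemma open_itv_between (a b : Rbar) (x y t : R) :
  open_itv a b x -> open_itv a b y -> x <= t <= y -> open_itv a b t.
Proof.
  intros [Hx _] [_ Hy] [H1 H2]; split.
  - exact (Rbar_lt_le_trans a x t Hx H1).
  - exact (Rbar_le_lt_trans t y b H2 Hy).
Qed.

Lemma is_derive_zero_open_itv_const (a b : Rbar) (h : R -> R) :
  (forall u, open_itv a b u -> is_derive h u 0) ->
  forall x y, open_itv a b x -> open_itv a b y -> h x = h y.
Proof.
  intros Hh.
  assert (Hlt : forall x y, open_itv a b x -> open_itv a b y -> x < y -> h x = h y).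
  { intros x y Hx Hy Hxy. apply (eq_is_derive h x y); auto.
    intros t Ht. apply Hh. exact (open_itv_between a b x y t Hx Hy Ht). }
  intros x y Hx Hy.
  destruct (Rtotal_order x y) as [H | [-> | H]]; auto.
  symmetry; auto.
Qed.

Lemma is_derive_cosh (x : R) : is_derive cosh x (sinh x).
Proof. apply is_derive_Reals, derivable_pt_lim_cosh. Qed.

Lemma is_derive_sinh (x : R) : is_derive sinh x (cosh x).
Proof. apply is_derive_Reals, derivable_pt_lim_sinh. Qed.

Lemma is_derive_asin (x : R) :
  -1 < x < 1 -> is_derive asin x (/ sqrt (1 - x ^ 2)).
Proof.
  intros Hx. apply is_derive_Reals.
  replace (/ sqrt (1 - x ^ 2))
    with (derive_pt asin x (derivable_pt_asin x Hx)).
  - apply derive_pt_eq_1 with (derivable_pt_asin x Hx). reflexivity.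
  - rewrite derive_pt_asin. unfold Rsqr, Rdiv. rewrite Rmult_1_l.
    do 3 f_equal. ring.
Qed.

Lemma smooth_on_is_derive (I : R -> Prop) (f : R -> R) (u : R) :
  smooth_on I f -> I u -> is_derive f u (Derive f u).
Proof. intros Hf Hu. apply Derive_correct. exact (Hf 1%nat u Hu). Qed.

Lemma smooth_on_is_derive2 (I : R -> Prop) (f : R -> R) (u : R) :
  smooth_on I f -> I u -> is_derive (Derive f) u (Derive (Derive f) u).
Proof. intros Hf Hu. apply Derive_correct. exact (Hf 2%nat u Hu). Qed.

(** * Tangent vectors, normal vectors and shape operators of the surface *)

Lemma tangent_vector_coords (X : R -> R -> R4) (u v a b : R) :
  tangent_vector X u v a b =
  (a * x1 (partial_u X u v) + b * x1 (partial_v X u v),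
   a * x2 (partial_u X u v) + b * x2 (partial_v X u v),
   a * x3 (partial_u X u v) + b * x3 (partial_v X u v),
   a * x4 (partial_u X u v) + b * x4 (partial_v X u v)).
Proof. reflexivity. Qed.

Lemma tangent_vector_hyperbolic_revolution (f g rho : R -> R) (u v a b : R) :
  tangent_vector (hyperbolic_revolution f g rho) u v a b =
  (a * Derive f u, a * Derive g u,
   a * (Derive rho u * sinh v) + b * (rho u * cosh v),
   a * (Derive rho u * cosh v) + b * (rho u * sinh v)).
Proof.
  rewrite tangent_vector_coords.
  unfold partial_u, partial_v, hyperbolic_revolution, x1, x2, x3, x4; simpl.
  rewrite !Derive_scal_l, !Derive_const, !Derive_scal.
  rewrite (is_derive_unique _ _ _ (is_derive_sinh v)).
  rewrite (is_derive_unique _ _ _ (is_derive_cosh v)).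
  rewrite !Rmult_0_r, !Rplus_0_r. reflexivity.
Qed.

Lemma normal_vector_hyperbolic_revolution (f g rho : R -> R) (u v : R) (w : R4) :
  normal_vector (hyperbolic_revolution f g rho) u v w ->
  x1 w * Derive f u + x2 w * Derive g u + x3 w * (Derive rho u * sinh v)
    - x4 w * (Derive rho u * cosh v) = 0 /\
  x3 w * (rho u * cosh v) - x4 w * (rho u * sinh v) = 0.
Proof.
  intros Hw. split.
  - generalize (Hw 1 0). rewrite tangent_vector_hyperbolic_revolution.
    unfold lorentz, x1, x2, x3, x4; simpl. lra.
  - generalize (Hw 0 1). rewrite tangent_vector_hyperbolic_revolution.
    unfold lorentz, x1, x2, x3, x4; simpl. lra.
Qed.

(** The right-hand side is [<e, L>] at [v = 0], where [X_uu = (f'', g'', 0, rho'')] and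
    [X_vv = (0, 0, 0, rho)]. It arises from [-<e_u, X_u> = <e, X_uu>] and [-<e_v, X_v> = <e, X_vv>].
    The point [v = 0] suffices later, since the equations sought involve [u] alone. *)
Lemma trace_shape_operator_hyperbolic_revolution
    (I : R -> Prop) (f g rho : R -> R) (V : R -> R -> Prop)
    (e : R -> R -> R4) (u : R) (A : matrix 2 2) :
  smooth_on I f -> smooth_on I g -> smooth_on I rho -> I u ->
  Derive f u ^ 2 + Derive g u ^ 2 - Derive rho u ^ 2 = 1 -> rho u <> 0 ->
  open2 V -> V u 0 -> smooth_map V e ->
  (forall s t, V s t -> normal_vector (hyperbolic_revolution f g rho) s t (e s t)) ->
  shape_operator (hyperbolic_revolution f g rho) e u 0 A ->
  trace A = x1 (e u 0) * Derive (Derive f) u + x2 (e u 0) * Derive (Derive g) u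
            - x4 (e u 0) * (Derive (Derive rho) u + / rho u).
Proof.
  intros Hf Hg Hrho Hu Hunit Hrho0 HV Vu He Hn [[_ Su] [_ Sv]].
  pose proof (smooth_on_is_derive2 I f u Hf Hu) as Df.
  pose proof (smooth_on_is_derive2 I g u Hg Hu) as Dg.
  pose proof (smooth_on_is_derive2 I rho u Hrho Hu) as Dr.
  destruct (He 1%nat u 0 Vu) as ((_ & E1 & _) & (_ & E2 & _) & (_ & _ & E3 & _) & (_ & E4 & E4' & _)).
  apply Derive_correct in E1, E2, E3, E4, E4'.
  (* The relations [<e, X_u> = 0] along the u-line and [<e, X_v> = 0] along the
     v-line through [(u, 0)] may be differentiated. *)
  assert (Hdu : is_derive (fun s => x1 (e s 0) * Derive f s + x2 (e s 0) * Derive g s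
                                    - x4 (e s 0) * Derive rho s) u 0).
  { apply (is_derive_ext_loc (fun _ => 0)); [| apply (is_derive_const (V := R_NormedModule))].
    generalize (locally_2d_1d_const_y _ _ _ (HV _ _ Vu)). apply filter_imp.
    intros s Hs. destruct (normal_vector_hyperbolic_revolution _ _ _ _ _ _ (Hn _ _ Hs)) as [H _].
    rewrite sinh_0, cosh_0 in H. lra. }
  assert (Hdv : is_derive (fun t => x3 (e u t) * (rho u * cosh t)
                                    - x4 (e u t) * (rho u * sinh t)) 0 0).
  { apply (is_derive_ext_loc (fun _ => 0)); [| apply (is_derive_const (V := R_NormedModule))].
    generalize (locally_2d_1d_const_x _ _ _ (HV _ _ Vu)). apply filter_imp.
    intros t Ht. destruct (normal_vector_hyperbolic_revolution _ _ _ _ _ _ (Hn _ _ Ht)) as [_ H].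
    symmetry; exact H. }
  apply is_derive_unique in Hdu, Hdv.
  assert (Ru : Derive (fun s => x1 (e s 0)) u * Derive f u
               + x1 (e u 0) * Derive (Derive f) u
               + (Derive (fun s => x2 (e s 0)) u * Derive g u
                  + x2 (e u 0) * Derive (Derive g) u)
               - (Derive (fun s => x4 (e s 0)) u * Derive rho u
                  + x4 (e u 0) * Derive (Derive rho) u) = 0).
  { refine (eq_trans (eq_sym _) Hdu). apply is_derive_unique.
    exact (is_derive_minus _ _ _ _ _
      (is_derive_plus _ _ _ _ _
        (is_derive_mult _ _ _ _ _ E1 Df Rmult_comm)
        (is_derive_mult _ _ _ _ _ E2 Dg Rmult_comm))
      (is_derive_mult _ _ _ _ _ E4 Dr Rmult_comm)). }
  assert (Rv : Derive (fun t => x3 (e u t)) 0 * (rho u * cosh 0)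
               + x3 (e u 0) * (rho u * sinh 0)
               - (Derive (fun t => x4 (e u t)) 0 * (rho u * sinh 0)
                  + x4 (e u 0) * (rho u * cosh 0)) = 0).
  { refine (eq_trans (eq_sym _) Hdv). apply is_derive_unique.
    exact (is_derive_minus _ _ _ _ _
      (is_derive_mult _ _ _ _ _ E3 (is_derive_scal _ _ (rho u) _ (is_derive_cosh 0)) Rmult_comm)
      (is_derive_mult _ _ _ _ _ E4' (is_derive_scal _ _ (rho u) _ (is_derive_sinh 0)) Rmult_comm)). }
  rewrite sinh_0, cosh_0 in Rv.
  (* The defect left by the tangential component is normal. Pairing it with [X_u], respectively
     [X_v], isolates a diagonal entry of [A], because [X_u] and [X_v] are orthogonal. *)
  pose proof (Su 1 0) as Su1. pose proof (Sv 0 1) as Sv1.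
  rewrite !tangent_vector_hyperbolic_revolution, sinh_0, cosh_0 in Su1, Sv1.
  set (A00 := coeff_mat 0 A 0 0) in *.
  set (A11 := coeff_mat 0 A 1 1) in *.
  assert (HA00 : - Derive (fun s => x1 (e s 0)) u * Derive f u
                 - Derive (fun s => x2 (e s 0)) u * Derive g u
                 + Derive (fun s => x4 (e s 0)) u * Derive rho u = A00).
  { transitivity (A00 * 1); [| ring]. rewrite <- Hunit.
    apply Rminus_diag_uniq. refine (eq_trans _ Su1).
    unfold lorentz, partial_u, x1, x2, x3, x4; simpl. unfold minus, plus, opp; simpl.
    unfold plus, opp; simpl.
    ring. }
  assert (HA11 : - Derive (fun t => x3 (e u t)) 0 = A11 * rho u).
  { apply (Rmult_eq_reg_r (rho u)); auto.
    apply Rminus_diag_uniq. refine (eq_trans _ Sv1).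
    unfold lorentz, partial_v, x1, x2, x3, x4; simpl. unfold minus, plus, opp; simpl.
    unfold plus, opp; simpl.
    ring. }
  unfold trace. fold A00 A11. rewrite <- HA00.
  replace A11 with (- Derive (fun t => x3 (e u t)) 0 / rho u)
    by (rewrite HA11; field; assumption).
  (* This is [Rv] divided by [rho u]; it produces the term in [/ rho u], which is the contribution
     of [X_vv / rho^2]. *)
  replace (Derive (fun t => x3 (e u t)) 0) with (x4 (e u 0)).
  2: { apply (Rmult_eq_reg_r (rho u)); auto. lra. }
  unfold Rdiv. lra.
Qed.

(** * From maximality to differential equations *)

(** Three orthonormal vectors form a basis of the three-dimensional Lorentz space, and a vector
    orthogonal to a basis is zero. It serves for [X_u], [e3], [e4] at [v = 0], with the third
    coordinate dropped. *)
Lemma lorentz3_nondegenerate (a b c p q r p' q' r' w1 w2 w3 : R) :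
  a * a + b * b - c * c = 1 ->
  p * p + q * q - r * r = 1 ->
  p' * p' + q' * q' - r' * r' = -1 ->
  p * a + q * b - r * c = 0 ->
  p' * a + q' * b - r' * c = 0 ->
  p * p' + q * q' - r * r' = 0 ->
  a * w1 + b * w2 - c * w3 = 0 ->
  p * w1 + q * w2 - r * w3 = 0 ->
  p' * w1 + q' * w2 - r' * w3 = 0 ->
  w1 = 0 /\ w2 = 0 /\ w3 = 0.
Proof.
  intros G11 G22 G33 G12 G13 G23 W1 W2 W3.
  set (d := a * (q * r' - r * q') - b * (p * r' - r * p') + c * (p * q' - q * p')).
  (* [d ^ 2] is minus the Gram determinant: the form has determinant [-1]. *)
  assert (Hd : d * d = 1).
  { replace (d * d) with
      (- ((a * a + b * b - c * c)
            * ((p * p + q * q - r * r) * (p' * p' + q' * q' - r' * r')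
               - (p * p' + q * q' - r * r') * (p * p' + q * q' - r * r'))
          - (p * a + q * b - r * c)
            * ((p * a + q * b - r * c) * (p' * p' + q' * q' - r' * r')
               - (p * p' + q * q' - r * r') * (p' * a + q' * b - r' * c))
          + (p' * a + q' * b - r' * c)
            * ((p * a + q * b - r * c) * (p * p' + q * q' - r * r')
               - (p * p + q * q - r * r) * (p' * a + q' * b - r' * c))))
      by (unfold d; ring).
    rewrite G11, G22, G33, G12, G13, G23. ring. }
  assert (Hd0 : d <> 0) by (intros H; rewrite H in Hd; lra).
  (* Cramer's rule: [d] times each coordinate is a combination of the three pairings, with
     two-by-two minors as coefficients up to sign. *)
  repeat split; apply (Rmult_eq_reg_l d); auto; rewrite Rmult_0_r.
  - replace (d * w1) with
      ((q * r' - r * q') * (a * w1 + b * w2 - c * w3)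
       - (b * r' - c * q') * (p * w1 + q * w2 - r * w3)
       + (b * r - c * q) * (p' * w1 + q' * w2 - r' * w3)) by (unfold d; ring).
    rewrite W1, W2, W3. ring.
  - replace (d * w2) with
      (- (p * r' - r * p') * (a * w1 + b * w2 - c * w3)
       + (a * r' - c * p') * (p * w1 + q * w2 - r * w3)
       - (a * r - c * p) * (p' * w1 + q' * w2 - r' * w3)) by (unfold d; ring).
    rewrite W1, W2, W3. ring.
  - replace (d * w3) with
      (- ((p * q' - q * p') * (a * w1 + b * w2 - c * w3)
       - (a * q' - b * p') * (p * w1 + q * w2 - r * w3)
       + (a * q - b * p) * (p' * w1 + q' * w2 - r' * w3))) by (unfold d; ring).
    rewrite W1, W2, W3. ring.
Qed.

(** At [v = 0], vanishing traces make [L + (rho' / rho) X_u] orthogonal to [e3] and [e4]; it is also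
    orthogonal to [X_u], hence zero. The three equations are its coordinates multiplied by
    [rho u]. *)
Lemma maximal_hyperbolic_revolution_ode (I : R -> Prop) (f g rho : R -> R) (u : R) :
  open I -> smooth_on I f -> smooth_on I g -> smooth_on I rho ->
  (forall t, I t -> Derive f t ^ 2 + Derive g t ^ 2 - Derive rho t ^ 2 = 1) ->
  maximal (fun t _ => I t) (hyperbolic_revolution f g rho) ->
  I u -> rho u <> 0 ->
  rho u * Derive (Derive f) u = - Derive rho u * Derive f u /\
  rho u * Derive (Derive g) u = - Derive rho u * Derive g u /\
  rho u * Derive (Derive rho) u + 1 = - Derive rho u ^ 2.
Proof.
  intros HI Hf Hg Hrho Hunit [_ Hmax] Hu Hr.
  destruct (Hmax u 0 Hu) as (V & e3 & e4 & A3 & A4 & HV & _ & Vu & (S3 & S4 & HF) & HA3 & HA4 & H0).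
  pose proof (trace_shape_operator_hyperbolic_revolution I f g rho V e3 u A3 Hf Hg Hrho Hu
    (Hunit u Hu) Hr HV Vu S3 (fun s t K => proj1 (HF s t K)) HA3) as T3.
  pose proof (trace_shape_operator_hyperbolic_revolution I f g rho V e4 u A4 Hf Hg Hrho Hu
    (Hunit u Hu) Hr HV Vu S4 (fun s t K => proj1 (proj2 (HF s t K))) HA4) as T4.
  destruct (HF u 0 Vu) as (N3 & N4 & G33 & G44 & G34).
  apply normal_vector_hyperbolic_revolution in N3, N4.
  rewrite sinh_0, cosh_0 in N3, N4.
  destruct N3 as [N3u N3v], N4 as [N4u N4v].
  (* Differentiating the unit speed condition gives [<X_u, X_uu> = 0]. *)
  assert (Hodd : Derive f u * Derive (Derive f) u + Derive g u * Derive (Derive g) u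
                 - Derive rho u * Derive (Derive rho) u = 0).
  { pose proof (smooth_on_is_derive2 I f u Hf Hu) as Df.
    pose proof (smooth_on_is_derive2 I g u Hg Hu) as Dg.
    pose proof (smooth_on_is_derive2 I rho u Hrho Hu) as Dr.
    assert (D0 : is_derive (fun t => Derive f t * Derive f t + Derive g t * Derive g t
                                     - Derive rho t * Derive rho t) u 0).
    { apply (is_derive_ext_loc (fun _ => 1)); [| apply (is_derive_const (V := R_NormedModule))].
      apply (filter_imp I); [| exact (HI u Hu)].
      intros t Ht. refine (eq_trans (eq_sym (Hunit t Ht)) _). ring. }
    apply is_derive_unique in D0.
    pose proof (eq_trans (eq_sym (is_derive_unique _ _ _
      (is_derive_minus _ _ _ _ _
        (is_derive_plus _ _ _ _ _
          (is_derive_mult _ _ _ _ _ Df Df Rmult_comm)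
          (is_derive_mult _ _ _ _ _ Dg Dg Rmult_comm))
        (is_derive_mult _ _ _ _ _ Dr Dr Rmult_comm)))) D0) as K.
    unfold minus, plus, opp, mult in K; simpl in K. lra. }
  destruct (e3 u 0) as [[[p q] z] r]. destruct (e4 u 0) as [[[p' q'] z'] r'].
  unfold lorentz, x1, x2, x3, x4 in *; simpl in *.
  (* At [v = 0] the vector [X_v] points along the third axis, so normal vectors have no third
     coordinate. *)
  assert (Hz : z = 0) by (apply (Rmult_eq_reg_r (rho u)); auto; lra).
  assert (Hz' : z' = 0) by (apply (Rmult_eq_reg_r (rho u)); auto; lra).
  subst z z'.
  pose proof (f_equal (fun w : R4 => fst (fst (fst w))) H0) as H1.
  pose proof (f_equal (fun w : R4 => snd (fst (fst w))) H0) as H2.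
  pose proof (f_equal (fun w : R4 => snd w) H0) as H4.
  change (0 = / 2 * trace A3 * p + - (/ 2 * trace A4 * p')) in H1.
  change (0 = / 2 * trace A3 * q + - (/ 2 * trace A4 * q')) in H2.
  change (0 = / 2 * trace A3 * r + - (/ 2 * trace A4 * r')) in H4.
  (* Pair [H = 0] with [e3] and with [e4]. *)
  assert (Z3 : trace A3 = 0).
  { transitivity (2 * ((/ 2 * trace A3 * p + - (/ 2 * trace A4 * p')) * p
      + (/ 2 * trace A3 * q + - (/ 2 * trace A4 * q')) * q
      - (/ 2 * trace A3 * r + - (/ 2 * trace A4 * r')) * r)).
    - transitivity (trace A3 * (p * p + q * q + 0 * 0 - r * r)
                    - trace A4 * (p * p' + q * q' + 0 * 0 - r * r')).
      + rewrite G33, G34. ring.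
      + field.
    - rewrite <- H1, <- H2, <- H4. ring. }
  assert (Z4 : trace A4 = 0).
  { transitivity (2 * ((/ 2 * trace A3 * p + - (/ 2 * trace A4 * p')) * p'
      + (/ 2 * trace A3 * q + - (/ 2 * trace A4 * q')) * q'
      - (/ 2 * trace A3 * r + - (/ 2 * trace A4 * r')) * r')).
    - transitivity (trace A3 * (p * p' + q * q' + 0 * 0 - r * r')
                    - trace A4 * (p' * p' + q' * q' + 0 * 0 - r' * r')).
      + rewrite G44, G34. ring.
      + field.
    - rewrite <- H1, <- H2, <- H4. ring. }
  rewrite Z3 in T3. rewrite Z4 in T4.
  set (F := Derive f u) in *. set (G := Derive g u) in *. set (P := Derive rho u) in *.
  set (F' := Derive (Derive f) u) in *. set (G' := Derive (Derive g) u) in *.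
  set (P' := Derive (Derive rho) u) in *.
  pose proof (Hunit u Hu) as U. fold F G P in U.
  (* [l] is [-<L, X_u>], so adding [l] times [X_u] removes the component of [L] along [X_u]. *)
  set (l := P / rho u).
  assert (Hl : l = P * / rho u) by reflexivity.
  destruct (lorentz3_nondegenerate F G P p q r p' q' r'
    (F' + l * F) (G' + l * G) (P' + / rho u + l * P)) as (W1 & W2 & W3); try lra.
  (* The factors [1] and [0] here and below are remnants of unfolded squares and of [cosh 0],
     [sinh 0]; they keep the terms in the shape of [U], [N3u] and [N4u]. *)
  - transitivity (F * F' + G * G' - P * P' - P * / rho u + l * (F * (F * 1) + G * (G * 1) - P * (P * 1))).
    + ring.
    + rewrite U, Hodd, Hl. ring.
  - transitivity (p * F' + q * G' - r * (P' + / rho u) + l * (p * F + q * G + 0 * (P * 0) - r * (P * 1))).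
    + ring.
    + rewrite <- T3, N3u. ring.
  - transitivity (p' * F' + q' * G' - r' * (P' + / rho u) + l * (p' * F + q' * G + 0 * (P * 0) - r' * (P * 1))).
    + ring.
    + rewrite <- T4, N4u. ring.
  - rewrite Hl in W1, W2, W3.
    repeat split; apply Rminus_diag_uniq.
    + transitivity (rho u * (F' + P * / rho u * F)); [field | rewrite W1; ring]; auto.
    + transitivity (rho u * (G' + P * / rho u * G)); [field | rewrite W2; ring]; auto.
    + transitivity (rho u * (P' + / rho u + P * / rho u * P)); [field | rewrite W3; ring]; auto.
Qed.

(** * Integration of the differential equations *)

Lemma open_open_itv (a b : Rbar) : open (open_itv a b).
Proof. apply open_and; [apply open_Rbar_gt | apply open_Rbar_lt]. Qed.

Theorem theorem4p6 (a b : Rbar) (f g rho : R -> R)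
  (Hf : smooth_on (open_itv a b) f)
  (Hg : smooth_on (open_itv a b) g)
  (Hrho : smooth_on (open_itv a b) rho)
  (Hunit : forall u, open_itv a b u ->
     Derive f u ^ 2 + Derive g u ^ 2 - Derive rho u ^ 2 = 1)
  (Hf' : forall u, open_itv a b u -> Derive f u <> 0)
  (Hg' : forall u, open_itv a b u -> Derive g u <> 0)
  (Hrho' : forall u, open_itv a b u -> Derive rho u <> 0)
  (Hrho0 : forall u, open_itv a b u -> rho u <> 0)
  (Hmax : maximal (fun u _ => open_itv a b u) (hyperbolic_revolution f g rho)) :
  (exists (n : R4) (c : R), spacelike n /\
     forall u v, open_itv a b u -> HP n c (hyperbolic_revolution f g rho u v)) /\
  (exists C1 C2 C3 m k sf srho : R,
     0 < C3 /\ (sf = 1 \/ sf = -1) /\ (srho = 1 \/ srho = -1) /\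
     forall u, open_itv a b u ->
       f u = sf * (sqrt C3 / sqrt (1 + C2 ^ 2)) * asin ((u - C1) / sqrt C3) + m /\
       g u = C2 * f u + k /\
       rho u = srho * sqrt (C3 - (u - C1) ^ 2)).

Proof.
  (* The interval may be empty, and then any constants do. Otherwise a base point [u0] fixes the
     constants of integration. *)
  destruct (classic (exists u, open_itv a b u)) as [[u0 Hu0] | Hempty].
  2: { split.
    - exists (1, 0, 0, 0), 0. split.
      + split.
        * intros E. apply (f_equal (fun w : R4 => fst (fst (fst w)))) in E.
          simpl in E. unfold zero in E; simpl in E. lra.
        * unfold lorentz, x1, x2, x3, x4; simpl. lra.
      + intros u v Hu. exfalso. eauto.
    - exists 0, 0, 1, 0, 0, 1, 1. repeat split; auto; try lra; exfalso; eauto. }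
  assert (ODE := fun u Hu => maximal_hyperbolic_revolution_ode (open_itv a b) f g rho u
    (open_open_itv a b) Hf Hg Hrho Hunit Hmax Hu (Hrho0 u Hu)).
  assert (Df := fun u => smooth_on_is_derive _ f u Hf).
  assert (Dg := fun u => smooth_on_is_derive _ g u Hg).
  assert (Dr := fun u => smooth_on_is_derive _ rho u Hrho).
  assert (Df2 := fun u => smooth_on_is_derive2 _ f u Hf).
  assert (Dg2 := fun u => smooth_on_is_derive2 _ g u Hg).
  assert (Dr2 := fun u => smooth_on_is_derive2 _ rho u Hrho).
  assert (Hconst := fun h Hh u Hu => is_derive_zero_open_itv_const a b h Hh u u0 Hu Hu0).
  (* Values at [u0] of the conserved quantities [rho f'], [rho g'] and [rho rho' + u]; the ratio
     [C2] is then the constant slope [g' / f']. *)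
  set (A := rho u0 * Derive f u0).
  set (B := rho u0 * Derive g u0).
  set (C1 := rho u0 * Derive rho u0 + u0).
  set (C2 := B / A).
  set (C3 := A ^ 2 + B ^ 2).
  assert (HA0 : A <> 0) by (apply Rmult_integral_contrapositive; auto).
  assert (HA : forall u, open_itv a b u -> rho u * Derive f u = A).
  { apply (Hconst (fun u => rho u * Derive f u)). intros u Hu.
    evar_last.
    - exact (is_derive_mult _ _ _ _ _ (Dr u Hu) (Df2 u Hu) Rmult_comm).
    - destruct (ODE u Hu) as (E & _). unfold plus, mult; simpl. lra. }
  assert (HB : forall u, open_itv a b u -> rho u * Derive g u = B).
  { apply (Hconst (fun u => rho u * Derive g u)). intros u Hu.
    evar_last.
    - exact (is_derive_mult _ _ _ _ _ (Dr u Hu) (Dg2 u Hu) Rmult_comm).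
    - destruct (ODE u Hu) as (_ & E & _). unfold plus, mult; simpl. lra. }
  assert (HC1 : forall u, open_itv a b u -> rho u * Derive rho u + u = C1).
  { apply (Hconst (fun u => rho u * Derive rho u + u)). intros u Hu.
    evar_last.
    - exact (is_derive_plus _ _ _ _ _
        (is_derive_mult _ _ _ _ _ (Dr u Hu) (Dr2 u Hu) Rmult_comm) (is_derive_id u)).
    - destruct (ODE u Hu) as (_ & _ & E). unfold plus, mult, one; simpl. lra. }
  (* This is the unit speed condition multiplied by [rho ^ 2], with [rho rho' = C1 - u]. *)
  assert (HC3 : forall u, open_itv a b u -> C3 - (u - C1) ^ 2 = rho u ^ 2).
  { intros u Hu. unfold C3.
    rewrite <- (HA u Hu), <- (HB u Hu), <- (HC1 u Hu).
    transitivity (rho u ^ 2 * (Derive f u ^ 2 + Derive g u ^ 2 - Derive rho u ^ 2)).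
    - ring.
    - rewrite (Hunit u Hu). ring. }
  assert (C3pos : 0 < C3).
  { pose proof (pow2_gt_0 A HA0). pose proof (pow2_ge_0 B). unfold C3. lra. }
  set (q := fun u => sqrt (C3 - (u - C1) ^ 2)).
  assert (Hq2 : forall u, open_itv a b u -> 0 < C3 - (u - C1) ^ 2).
  { intros u Hu. rewrite (HC3 u Hu). apply pow2_gt_0; auto. }
  assert (Hq : forall u, open_itv a b u -> 0 < q u).
  { intros u Hu. apply sqrt_lt_R0, Hq2, Hu. }
  assert (Hqq : forall u, open_itv a b u -> q u ^ 2 = rho u ^ 2).
  { intros u Hu. unfold q. rewrite pow2_sqrt; auto using Rlt_le. }
  set (s := rho u0 / q u0).
  (* [rho / |rho|] has derivative zero, so [rho] keeps its sign. *)
  assert (Hs : forall u, open_itv a b u -> rho u = s * q u).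
  { intros u Hu. cut (rho u / q u = s).
    - intros <-. field. apply Rgt_not_eq, Hq, Hu.
    - revert u Hu. apply (Hconst (fun u => rho u / q u)). intros u Hu.
      assert (Q : is_derive q u (- (u - C1) / q u)).
      { evar_last.
        - apply (is_derive_sqrt (fun t => C3 - (t - C1) ^ 2) u (- 2 * (u - C1))); auto.
          auto_derive; auto. ring.
        - fold (q u). field. apply Rgt_not_eq, Hq, Hu. }
      evar_last.
      + apply (is_derive_div rho q u _ _ (Dr u Hu) Q). apply Rgt_not_eq, Hq, Hu.
      (* Both [rho] and [q] solve [y y' = C1 - u], so the derivative of the quotient is a multiple
         of [q ^ 2 - rho ^ 2]. *)
      + replace (Derive rho u) with ((C1 - u) / rho u).
        * transitivity ((C1 - u) * (q u ^ 2 - rho u ^ 2) / (rho u * q u * q u ^ 2)).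
          { field. split; auto. apply Rgt_not_eq, Hq, Hu. }
          rewrite (Hqq u Hu). unfold Rdiv. ring.
        * rewrite <- (HC1 u Hu). field. auto. }
  assert (Hs1 : s = 1 \/ s = -1).
  { assert (E : s ^ 2 = 1).
    { unfold s. transitivity (rho u0 ^ 2 / q u0 ^ 2).
      - field. apply Rgt_not_eq, Hq, Hu0.
      - rewrite (Hqq u0 Hu0). field. auto. }
    assert (E' : (s - 1) * (s + 1) = 0) by lra.
    apply Rmult_integral in E'. destruct E'; [left | right]; lra. }
  assert (HC2 : forall u, open_itv a b u -> g u - C2 * f u = g u0 - C2 * f u0).
  { apply (Hconst (fun u => g u - C2 * f u)). intros u Hu.
    evar_last.
    - exact (is_derive_minus _ _ _ _ _ (Dg u Hu) (is_derive_scal _ _ C2 _ (Df u Hu))).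
    - unfold minus, plus, opp; simpl. unfold C2.
      replace (Derive g u) with (B / rho u) by (rewrite <- (HB u Hu); field; auto).
      replace (Derive f u) with (A / rho u) by (rewrite <- (HA u Hu); field; auto).
      field. auto. }
  (* Since [C3 = A ^ 2 * (1 + C2 ^ 2)], this coefficient is the absolute value of [A]; hence the
     square root in the denominator. *)
  set (c := sqrt C3 / sqrt (1 + C2 ^ 2)).
  assert (HcA : c = Rabs A).
  { unfold c. rewrite <- sqrt_div_alt.
    - rewrite <- sqrt_Rsqr_abs. f_equal. unfold C3, C2, Rsqr. field.
      split; auto. apply Rgt_not_eq. exact C3pos.
    - pose proof (pow2_ge_0 C2). lra. }
  assert (Hsgn : exists e, (e = 1 \/ e = -1) /\ A = e * c).
  { rewrite HcA. unfold Rabs. destruct (Rcase_abs A).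
    - exists (-1). split; auto. ring.
    - exists 1. split; auto. ring. }
  destruct Hsgn as (e & He & HAe).
  assert (HsC : 0 < sqrt C3) by (apply sqrt_lt_R0; auto).
  assert (HsC2 : sqrt C3 ^ 2 = C3) by (apply pow2_sqrt; lra).
  (* The sign of [f' = A / rho]: with [A = e * c] and [rho = s * q], one gets [f' = sf * c / q], and
     [c / q] is the derivative of [c * asin ((u - C1) / sqrt C3)]. *)
  set (sf := e * s).
  set (phi := fun u => f u - sf * c * asin ((u - C1) / sqrt C3)).
  assert (Hphi : forall u, open_itv a b u -> phi u = phi u0).
  { apply Hconst. intros u Hu.
    (* This identity both places the argument of [asin] strictly between -1 and 1 and evaluates the
       square root in its derivative. *)
    assert (Hx : 1 - ((u - C1) / sqrt C3) ^ 2 = (q u / sqrt C3) ^ 2).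
    { transitivity ((sqrt C3 ^ 2 - (u - C1) ^ 2) / sqrt C3 ^ 2).
      - field. lra.
      - rewrite HsC2 at 1. rewrite (HC3 u Hu), <- (Hqq u Hu). field. lra. }
    assert (Hqc : 0 < q u / sqrt C3) by (apply Rdiv_lt_0_compat; auto).
    assert (Hbd : -1 < (u - C1) / sqrt C3 < 1).
    { pose proof (pow2_gt_0 _ (Rgt_not_eq _ _ Hqc)) as K. rewrite <- Hx in K.
      split; nra. }
    pose proof (is_derive_asin _ Hbd) as Das.
    assert (Dlin : is_derive (fun t => (t - C1) / sqrt C3) u (/ sqrt C3)).
    { auto_derive; auto. field. lra. }
    evar_last.
    - exact (is_derive_minus _ _ _ _ _ (Df u Hu)
        (is_derive_scal _ _ (sf * c) _
          (is_derive_comp asin (fun t => (t - C1) / sqrt C3) u _ _ Das Dlin))).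
    - rewrite Hx, sqrt_pow2 by lra.
      unfold minus, plus, opp, scal; simpl. unfold mult; simpl.
      replace (Derive f u) with (A / rho u) by (rewrite <- (HA u Hu); field; auto).
      rewrite HAe, (Hs u Hu). unfold sf.
      pose proof (Hq u Hu).
      destruct Hs1 as [-> | ->]; field; lra. }
  split.
  (* The relation [g = C2 * f + k] read as a hyperplane equation; its normal has square norm
     [C2 ^ 2 + 1]. *)
  - exists (C2, -1, 0, 0), (C2 * f u0 - g u0). split.
    + split.
      * intros E. apply (f_equal (fun w : R4 => snd (fst (fst w)))) in E.
        simpl in E. unfold zero in E; simpl in E. lra.
      * unfold lorentz, x1, x2, x3, x4; simpl. pose proof (pow2_ge_0 C2). lra.
    + intros u v Hu. pose proof (HC2 u Hu).
      unfold HP, lorentz, hyperbolic_revolution, x1, x2, x3, x4; simpl. lra.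
  - exists C1, C2, C3, (phi u0), (g u0 - C2 * f u0), sf, s.
    split; [exact C3pos |]. split; [| split; [exact Hs1 |]].
    { unfold sf. destruct He as [-> | ->], Hs1 as [-> | ->]; lra. }
    intros u Hu. split; [| split].
    + rewrite <- (Hphi u Hu). unfold phi. fold c. ring.
    + pose proof (HC2 u Hu). lra.
    + exact (Hs u Hu).
Qed.
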